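(* In one round $t$ of the joint update described in the context, with $\phi=\phi_d^{(t)}$ and $r_t=g_t\circ\phi_d^{(t)}$ measurable, and $\delta\in(0,\tfrac14)$, $$e_d(\mu^{(t+1)},\phi)-e_d(\mu^{(t)},\phi)=\Gamma_t\qquad\text{and}\qquad P_\infty^{2\delta}(\mu^{(t+1)})-P_\infty^{2\delta}(\mu^{(t)})=\Theta_t,$$ where $\Gamma_t=\Gamma(\mu^{(t)},\phi;r_t,\beta)$ and $\Theta_t=\Theta(\mu^{(t)};r_t,\beta)$.
   Context: $\mathcal X$ (prompts) and $\mathcal Y$ (responses) are measurable spaces and $\nu$ is a probability measure on $\mathcal X$. There are $n\ge1$ annotators with measurable utilities $u_i:\mathcal X\times\mathcal Y\to\mathbb R$. Let $F(t)=1/(1+e^{-t})$ and $\bar p(x,y,y')=\frac1n\sum_{i=1}^nF(u_i(x,y)-u_i(x,y'))$. For a kernel $\mu=(\mu_x)_x$ of probability measures on $\mathcal Y$ and a measurable embedding $\phi:\mathcal X\times\mathcal Y\to\mathbb R^d$, $\tilde p_\phi(x,y,y')=\mathbb E_{(y_0,y_0')\sim\mu_x^{\otimes2}}[\bar p(x,y_0,y_0')\mid\phi(x,y_0)=\phi(x,y),\phi(x,y_0')=\phi(x,y')]$ (computed with respect to $\mu$), and $e_d(\mu,\phi)=\mathbb E_{x\sim\nu}\mathbb E_{(y,y')\sim\mu_x^{\otimes2}}[(\bar p-\tilde p_\phi)^2]$. $\mathcal{CC}_\infty^{2\delta}$ is the event, for $(x,y_1,y_2,y_3)$, that $\bar p(x,y_1,y_2),\bar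 p(x,y_2,y_3),\bar p(x,y_3,y_1)$ are all $\ge\frac12+2\delta$ or all $\le\frac12-2\delta$, and $P_\infty^{2\delta}(\mu)$ is its probability under $x\sim\nu$, $(y_1,y_2,y_3)\sim\mu_x^{\otimes3}$. Joint update: at iteration $t$ there are a response distribution $\mu_x^{(t)}$ (with joint law $\mathcal D_t$ of $(x,y,y')$, $x\sim\nu$, $(y,y')\sim(\mu_x^{(t)})^{\otimes2}$), an embedding $\phi_d^{(t)}$, and a reward $r_t=g_t\circ\phi_d^{(t)}$ minimizing the pairwise cross-entropy loss $\mathbb E_{\mathcal D_t}[-\bar p\log F(\Delta r)-(1-\bar p)\log(1-F(\Delta r))]$, $\Delta r(x,y,y')=r(x,y)-r(x,y')$. For a temperature $\beta>0$ the next response distribution is given by the soft update $d\mu_x^{(t+1)}/d\mu_x^{(t)}(y)\propto e^{\beta r_t(x,y)}$ (with normalizer assumed finite). With $\rho_{r,\beta}(x,y)=e^{\beta r(x,y)}/\mathbb E_{\mu_x}[e^{\beta r(x,\cdot)}]$, the tilt covariances are $$\Gamma(\mu,\phi;r,\beta)=\mathbb E_{x\sim\nu}\bigl[\mathrm{Cov}_{\mu_x^{\otimes2}}\bigl((\bar p-\tilde p_\phi)^2,\ \rho_{r,\beta}(x,y)\rho_{r,\beta}(x,y')\bigr)\bigr],$$ $$\Theta(\mu;r,\beta)=\mathbb E_{x\sim\nu}\bigl[\mathrm{Cov}_{\mu_x^{\otimes3}}\bigl(\mathbf 1_{\mathcal{CC}_\infty^{2\delta}},\ \rho_{r,\bet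a}(x,y_1)\rho_{r,\beta}(x,y_2)\rho_{r,\beta}(x,y_3)\bigr)\bigr].$$
   Formalization: The head g_t is itself assumed measurable, not only r_t = g_t∘φ; on general measurable spaces the identity for e_d can fail when r_t is measurable but is not a measurable function of φ. *)

(* Defs.v *)
From HB Require Import structures.
From mathcomp Require Import all_boot all_order all_algebra.
From mathcomp Require Import all_classical all_reals all_analysis.

Set Implicit Arguments.
Unset Strict Implicit.
Unset Printing Implicit Defensive.

Import Order.TTheory GRing.Theory Num.Theory.
Import numFieldNormedType.Exports.

Local Open Scope classical_set_scope.
Local Open Scope ring_scope.
Local Open Scope ereal_scope.

Section product_probability.
Context d1 d2 (T1 : measurableType d1) (T2 : measurableType d2) (R : realType).
Variables (P : probability T1 R) (Q : probability T2 R).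

Definition pprod : set (T1 * T2) -> \bar R := P \x Q.

HB.instance Definition _ := Measure.on pprod.

Let pprod_setT : pprod [set: T1 * T2] = 1.
Proof.
rewrite /pprod -setXTT product_measure1E//.
by rewrite -[LHS]/(P [set: T1] * Q [set: T2]) !probability_setT mule1.
Qed.

HB.instance Definition _ :=
  Measure_isProbability.Build _ _ _ pprod pprod_setT.

End product_probability.

Section kernel_fibers.
Context dX dY (X : measurableType dX) (Y : measurableType dY) (R : realType).
Variables (mu : R.-pker X ~> Y) (x : X).

Definition fiber : set Y -> \bar R := mu x.

HB.instance Definition _ := Measure.on fiber.
HB.instance Definition _ :=
  Measure_isProbability.Build _ _ _ fiber (prob_kernel x).

Definition fiber2 : probability (Y * Y)%type R := pprod fiber fiber.

Definition fiber3 : probability (Y * Y * Y)%type R := pprod fiber2 fiber.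

End kernel_fibers.

Section conditional_expectation.
Context dT dZ (T : measurableType dT) (Z : measurableType dZ) (R : realType).

(* [h z] is a version of the conditional expectation of [f] given [psi = z]:
   [h \o psi] is a conditional expectation of [f] given the sigma-algebra
   generated by [psi]. *)
Definition is_cond_exp (P : probability T R) (f : T -> R) (psi : T -> Z)
    (h : Z -> R) : Prop :=
  [/\ measurable_fun [set: Z] h,
      P.-integrable [set: T] (EFin \o (h \o psi)) &
      forall B : set Z, measurable B ->
        \int[P]_(w in psi @^-1` B) (h (psi w))%:E =
        \int[P]_(w in psi @^-1` B) (f w)%:E].

(* Versions agree almost everywhere for the law of [psi]; one of them is
   selected (they exist, by Radon-Nikodym, for [P]-integrable [f] and
   measurable [psi]). *)
Definition cond_exp (P : probability T R) (f : T -> R) (psi : T -> Z) : Z -> R :=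
  xget (fun=> 0%R) [set h | is_cond_exp P f psi h].

End conditional_expectation.

Section preferences.
Context dX dY (X : measurableType dX) (Y : measurableType dY) (R : realType).

Definition logistic (t : R) : R := ((1 + expR (- t))^-1)%R.

Variables (n : nat) (u : 'I_n -> X * Y -> R).

Definition pbar (x : X) (y y' : Y) : R :=
  (n%:R^-1 * \sum_(i < n) logistic (u i (x, y) - u i (x, y')))%R.

Definition ptilde d (mu : R.-pker X ~> Y) (phi : X * Y -> d.-tuple R)
    (x : X) (y y' : Y) : R :=
  cond_exp (fiber2 mu x)
    (fun z => pbar x z.1 z.2)
    (fun z => (phi (x, z.1), phi (x, z.2)))
    (phi (x, y), phi (x, y')).

Definition sq_residual d (mu : R.-pker X ~> Y) (phi : X * Y -> d.-tuple R)
    (x : X) (z : Y * Y) : R :=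
  ((pbar x z.1 z.2 - ptilde mu phi x z.1 z.2) ^+ 2)%R.

Definition e_ d (nu : probability X R) (mu : R.-pker X ~> Y)
    (phi : X * Y -> d.-tuple R) : \bar R :=
  \int[nu]_x 'E_(fiber2 mu x)[sq_residual mu phi x].

Definition CC (eps : R) (x : X) : set (Y * Y * Y) :=
  [set w | let: (y1, y2, y3) := w in
    [/\ 2^-1 + eps <= pbar x y1 y2, 2^-1 + eps <= pbar x y2 y3
      & 2^-1 + eps <= pbar x y3 y1]%R \/
    [/\ pbar x y1 y2 <= 2^-1 - eps, pbar x y2 y3 <= 2^-1 - eps
      & pbar x y3 y1 <= 2^-1 - eps]%R].

Definition P_CC (eps : R) (nu : probability X R) (mu : R.-pker X ~> Y) : \bar R :=
  \int[nu]_x fiber3 mu x (CC eps x).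

Definition Delta (r : X * Y -> R) (x : X) (y y' : Y) : R :=
  (r (x, y) - r (x, y'))%R.

(* Its integrand is nonnegative, so the expectation under the joint law of
   [(x, y, y')] is this iterated integral, possibly infinite. *)
Definition ce_loss (nu : probability X R) (mu : R.-pker X ~> Y)
    (r : X * Y -> R) : \bar R :=
  \int[nu]_x 'E_(fiber2 mu x)[fun z =>
    (- pbar x z.1 z.2 * ln (logistic (Delta r x z.1 z.2))
     - (1 - pbar x z.1 z.2) * ln (1 - logistic (Delta r x z.1 z.2)))%R].

Definition normalizer (mu : R.-pker X ~> Y) (r : X * Y -> R) (beta : R)
    (x : X) : \bar R :=
  'E_(fiber mu x)[fun y => expR (beta * r (x, y))%R].

Definition rho (mu : R.-pker X ~> Y) (r : X * Y -> R) (beta : R)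
    (x : X) (y : Y) : R :=
  (expR (beta * r (x, y)) / fine (normalizer mu r beta x))%R.

Definition soft_update (mu mu' : R.-pker X ~> Y) (r : X * Y -> R) (beta : R) :
    Prop :=
  forall x, normalizer mu r beta x < +oo /\
    forall A, measurable A ->
      mu' x A = \int[mu x]_(y in A) (rho mu r beta x y)%:E.

(* [mu'] is the response distribution obtained from [mu] by one round in which
   the reward is [g \o phi]; the loss is minimized over all rewards that factor
   through [phi]. *)
Record joint_update d (nu : probability X R) (mu mu' : R.-pker X ~> Y)
    (phi : X * Y -> d.-tuple R) (g : d.-tuple R -> R) (beta : R) : Prop := {
  measurable_embedding : measurable_fun [set: X * Y] phi ;
  measurable_head : measurable_fun [set: d.-tuple R] g ;
  loss_minimizer : forall g' : d.-tuple R -> R,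
    measurable_fun [set: d.-tuple R] g' ->
    ce_loss nu mu (g \o phi) <= ce_loss nu mu (g' \o phi) ;
  soft_updated : soft_update mu mu' (g \o phi) beta }.

Definition Gamma d (nu : probability X R) (mu : R.-pker X ~> Y)
    (phi : X * Y -> d.-tuple R) (r : X * Y -> R) (beta : R) : \bar R :=
  \int[nu]_x covariance (fiber2 mu x)
    (sq_residual mu phi x)
    (fun z => rho mu r beta x z.1 * rho mu r beta x z.2)%R.

Definition Theta (eps : R) (nu : probability X R) (mu : R.-pker X ~> Y)
    (r : X * Y -> R) (beta : R) : \bar R :=
  \int[nu]_x covariance (fiber3 mu x)
    (\1_(CC eps x))
    (fun w => rho mu r beta x w.1.1 * rho mu r beta x w.1.2 *
              rho mu r beta x w.2)%R.

End preferences.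

(* Main.v *)
From HB Require Import structures.
Require Import Defs.
From mathcomp Require Import all_boot all_order all_algebra.
From mathcomp Require Import all_classical all_reals all_analysis.
From mathcomp Require Import measurable_realfun.
From mathcomp Require Import lra ring.

(* The density of the updated response law is a function of the embedding, so
   by the pull-out property every version of the conditional expectation of
   [pbar] given the embedding remains a version after the update: the squared
   residual and the cycle indicator are bounded functions that do not change
   with the law, and for such a function [X] and a density [w] one has
   E'[X] - E[X] = E[X w] - E[X] E[w] = Cov(X, w), fibre by fibre.
   Integrating this over prompts requires the mean squared residual to be
   measurable in the prompt, although the versions of the conditional
   expectation are selected independently for each prompt.  It is, because the
   conditional expectation is the least-squares approximation of [pbar], so that
   the mean squared residual is the infimum of the mean squared errors of
   countably many explicit functions of the embedding, which are L1-dense for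
   every law of the embedding. *)

Set Implicit Arguments.
Unset Strict Implicit.
Unset Printing Implicit Defensive.

Import Order.TTheory GRing.Theory Num.Theory.
Import numFieldNormedType.Exports.
Local Open Scope classical_set_scope.
Local Open Scope ring_scope.

(** * Weighted integrals *)

Import HBNNSimple.

(** Simple functions increasing to [k] reduce both sides to weighted masses of preimages of level
    sets, which agree by hypothesis. Both the density formula and the pull-out property are
    instances. *)
Lemma eq_integral_weight d1 d2 d3 (T1 : measurableType d1)
    (T2 : measurableType d2) (Z : measurableType d3) (R : realType)
    (m1 : {measure set T1 -> \bar R}) (m2 : {measure set T2 -> \bar R})
    (a1 : T1 -> Z) (a2 : T2 -> Z) (w1 : T1 -> R) (w2 : T2 -> R)
    (k : Z -> \bar R) :
  measurable_fun [set: T1] a1 -> measurable_fun [set: T2] a2 ->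
  measurable_fun [set: T1] w1 -> measurable_fun [set: T2] w2 ->
  (forall x, 0 <= w1 x) -> (forall x, 0 <= w2 x) ->
  (forall B, measurable B ->
    \int[m1]_(x in a1 @^-1` B) (w1 x)%:E =
    \int[m2]_(x in a2 @^-1` B) (w2 x)%:E)%E ->
  measurable_fun [set: Z] k -> (forall z, 0 <= k z)%E ->
  (\int[m1]_x (k (a1 x) * (w1 x)%:E) = \int[m2]_x (k (a2 x) * (w2 x)%:E))%E.
Proof.
move=> ma1 ma2 mw1 mw2 w1_ge0 w2_ge0 w12 mk k_ge0.
pose kn := nnsfun_approx measurableT mk.
(* The right-hand side depends on [m], [a] and [w] only through the weighted masses of preimages
   under [a]. *)
have int_lim d (T : measurableType d) (m : {measure set T -> \bar R})
    (a : T -> Z) (w : T -> R) : measurable_fun [set: T] a ->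
    measurable_fun [set: T] w -> (forall x, 0 <= w x) ->
    (\int[m]_x (k (a x) * (w x)%:E) =
      limn (fun n => \sum_(r \in range (kn n))
        (r%:E * \int[m]_(x in a @^-1` (kn n @^-1` [set r])) (w x)%:E)))%E.
  move=> ma mw w_ge0.
  have mkn n : measurable_fun [set: T] (fun x => (kn n (a x))%:E).
    exact/measurable_EFinP/measurableT_comp.
  transitivity (\int[m]_x limn (fun n => (kn n (a x))%:E * (w x)%:E))%E.
    apply: eq_integral => x _; apply/esym/cvg_lim => //.
    by apply: cvgeZr => //; exact: cvg_nnsfun_approx.
  rewrite monotone_convergence//; last 3 first.
  - by move=> n; apply: emeasurable_funM => //; exact/measurable_EFinP.
  - by move=> n x _; rewrite mule_ge0// lee_fin.
  - move=> x _ n p np; rewrite lee_wpmul2r// lee_fin//.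
    exact/lefP/nd_nnsfun_approx.
  congr (limn _); apply/funext => n.
  under eq_integral => x _.
    rewrite fimfunE -fsumEFin// ge0_mule_fsuml; last first.
      by move=> r; exact: nnfun_muleindic_ge0.
    over.
  rewrite ge0_integral_fsum//; last 2 first.
  - move=> r; apply: emeasurable_funM; apply/measurable_EFinP => //.
    by apply: measurable_funM => //; apply: measurableT_comp ma => //.
  - by move=> r x _; rewrite mule_ge0 ?lee_fin//; exact: nnfun_muleindic_ge0.
  apply: eq_fsbigr => r; rewrite inE => -[z _ <-].
  have mr : measurable (a @^-1` (kn n @^-1` [set kn n z])).
    by rewrite -[X in measurable X]setTI; exact: ma.
  transitivity (\int[m]_x ((kn n z)%:E *
      ((w x)%:E * (\1_(a @^-1` (kn n @^-1` [set kn n z])) x)%:E)))%E.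
    by apply: eq_integral => x _; rewrite EFinM -muleA [((w x)%:E * _)%E]muleC.
  rewrite ge0_integralZl//; last 3 first.
  - by apply: emeasurable_funM => //; exact/measurable_EFinP.
  - by move=> x _; rewrite mule_ge0// lee_fin.
  - by rewrite lee_fin.
  congr *%E; rewrite [RHS]integral_mkcond; apply: eq_integral => x _.
  by rewrite patchE indicE; case: ifPn => _; rewrite ?mule1 ?mule0.
rewrite !int_lim//; congr (limn _); apply/funext => n.
by apply: eq_fsbigr => r _; rewrite w12.
Qed.

Lemma integral_density d (T : measurableType d) (R : realType)
    (P P' : {measure set T -> \bar R}) (w : T -> R) (F : T -> \bar R) :
  measurable_fun [set: T] w -> (forall x, 0 <= w x) ->
  (forall A, measurable A -> P' A = \int[P]_(x in A) (w x)%:E)%E ->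
  measurable_fun [set: T] F -> (forall x, 0 <= F x)%E ->
  (\int[P']_x F x = \int[P]_x (F x * (w x)%:E))%E.
Proof.
move=> mw w_ge0 P'E mF F_ge0.
rewrite -(@eq_integral_weight _ _ _ _ _ _ _ P' P id id (cst 1) w)//.
- by apply: eq_integral => x _; rewrite mule1.
- move=> B mB; rewrite !preimage_id -P'E// -[RHS]mul1e -integral_cst//.
Qed.

(** * Conditional expectations *)

Lemma integrable_bounded01 d (T : measurableType d) (R : realType)
    (P : probability T R) (X : T -> R) :
  measurable_fun [set: T] X -> (forall t, 0 <= X t <= 1) ->
  P.-integrable [set: T] (EFin \o X).
Proof.
move=> mX X01; have := finite_measure_integrable_cst P 1 measurableT.
apply: le_integrable => //; first exact/measurable_EFinP.
move=> t _ /=; rewrite lee_fin normr1.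
by have /andP[X0 X1] := X01 t; rewrite ger0_norm.
Qed.

(** Serves to clamp a Radon-Nikodym derivative: overwriting [a] by [b] on [D] keeps the integral
    over [E], since the two agree in mean on [E] within [D]. *)
Lemma eq_integral_patch d (T : measurableType d) (R : realType)
    (m : {measure set T -> \bar R}) (a b c : T -> \bar R) (D E : set T) :
  measurable D -> measurable E ->
  measurable_fun [set: T] a -> measurable_fun [set: T] c ->
  {in D, c =1 b} -> {in ~` D, c =1 a} ->
  (\int[m]_(x in E `&` D) a x = \int[m]_(x in E `&` D) b x)%E ->
  (\int[m]_(x in E) c x = \int[m]_(x in E) a x)%E.
Proof.
move=> mD mE ma mc cb ca ab.
have mED : measurable (E `&` D) by exact: measurableI.
have mE'D : measurable (E `&` ~` D) by apply: measurableI => //; exact: measurableC.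
have ED : [disjoint E `&` D & E `&` ~` D].
  by apply/disj_setPS => x [[_ ?] [_]].
have -> : E = (E `&` D) `|` (E `&` ~` D) by rewrite -setIUr setUv setIT.
rewrite !integral_setU//; try exact: measurable_funTS.
congr +%E.
  rewrite ab; apply: eq_integral => x; rewrite inE => -[_ Dx].
  by rewrite cb// inE.
by apply: eq_integral => x; rewrite inE => -[_ Dx]; rewrite ca// inE.
Qed.

Section conditional_expectation_theory.
Context dT dZ (T : measurableType dT) (Z : measurableType dZ) (R : realType).
Variables (P : probability T R) (f : T -> R) (psi : T -> Z).
Hypothesis mf : measurable_fun [set: T] f.
Hypothesis f01 : forall t, 0 <= f t <= 1.
Hypothesis mpsi : measurable_fun [set: T] psi.

Let mpre B : measurable B -> measurable (psi @^-1` B).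
Proof. by move=> mB; rewrite -[X in measurable X]setTI; exact: mpsi. Qed.

Let mfun_psi := isMeasurableFun.Build _ _ _ _ psi mpsi.
Let Psi : {mfun T >-> Z} := HB.pack psi mfun_psi.
Let Q : probability Z R := distribution P Psi.

(** Transported to the law [Q] of [psi], both versions have the same integral over every measurable
    set, so they agree outside a [Q]-null set, whose preimage is [P]-null. *)
Lemma is_cond_exp_ae_unique (h1 h2 : Z -> R) :
  is_cond_exp P f psi h1 -> is_cond_exp P f psi h2 ->
  ae_eq P [set: T] (EFin \o (h1 \o psi)) (EFin \o (h2 \o psi)).
Proof.
move=> [mh1 ih1 h1E] [mh2 ih2 h2E].
have : ae_eq Q [set: Z] (EFin \o h1) (EFin \o h2).
  apply: integral_ae_eq => //.
  - apply: (integrable_pushforward mpsi) => //; exact/measurable_EFinP.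
  - exact/measurable_EFinP.
  move=> B _ mB; rewrite !(integral_pushforward mpsi)//.
  - by rewrite [LHS]h1E// [RHS]h2E.
  - exact/measurable_EFinP.
  - exact: (integrableS measurableT (mpre mB)).
  - exact/measurable_EFinP.
  - exact: (integrableS measurableT (mpre mB)).
move=> [N [mN N0 hN]]; exists (psi @^-1` N); split => //.
- exact: mpre.
- by move=> t /= ht; apply: hN.
Qed.

(** The version is the Radon-Nikodym derivative of the image under [psi] of the measure with density
    [f], taken with respect to the law of [psi]. Clamping makes the bounds hold everywhere, so that
    they survive a change of law. *)
Lemma exists_cond_exp01 :
  exists h : Z -> R, is_cond_exp P f psi h /\ forall z, 0 <= h z <= 1.
Proof.
have intf := integrable_bounded01 P mf f01.
pose nu := pushforward (induced_charge intf) Psi.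
have nuE B : nu B = (\int[P]_(t in psi @^-1` B) (f t)%:E)%E by [].
have nu0 B : measurable B -> (0 <= nu B)%E.
  move=> mB; rewrite nuE integral_ge0// => t _.
  by rewrite lee_fin; have /andP[] := f01 t.
have nu1 B : measurable B -> (nu B <= Q B)%E.
  move=> mB; rewrite nuE -[leRHS](mul1e (P (psi @^-1` B))).
  rewrite -integral_cst; last exact: mpre.
  apply: ge0_le_integral => //; first exact: mpre.
  - by move=> t _; rewrite lee_fin; have /andP[] := f01 t.
  - exact/measurable_EFinP/measurable_funTS.
  - by move=> t _; rewrite lee_fin; have /andP[] := f01 t.
have nuQ : nu `<< Q.
  apply/null_content_dominatesP => B mB QB0.
  by apply/eqP; rewrite eq_le nu0// -QB0 nu1.
pose RN := Radon_Nikodym nu Q; pose h0 := RN mpsi.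
have h0fin z : h0 z \is a fin_num by exact: Radon_Nikodym_fin_num.
have ih0 : Q.-integrable [set: Z] h0 by exact: Radon_Nikodym_integrable.
have mh0 : measurable_fun [set: Z] h0 by exact: measurable_int ih0.
have h0E B : measurable B -> nu B = (\int[Q]_(z in B) h0 z)%E.
  exact: Radon_Nikodym_integral.
(* Where [h0] is at most 0, its integral over any set is at most 0 and, being a value of [nu], at
   least 0. Raising it to 0 there changes no set integral. *)
pose h1 z := maxe (h0 z) 0%E.
have mh1 : measurable_fun [set: Z] h1 by exact: measurable_maxe.
have h1E B : measurable B -> nu B = (\int[Q]_(z in B) h1 z)%E.
  move=> mB; rewrite h0E//; apply/esym.
  have mD : measurable [set z | (h0 z <= 0)%E].
    by rewrite -[X in measurable X]setTI; exact: emeasurable_fun_infty_c.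
  apply: (@eq_integral_patch _ _ _ Q h0 (cst 0%E) h1 [set z | (h0 z <= 0)%E]) => //.
  - by move=> z; rewrite inE /h1 /= => ?; rewrite max_r.
  - by move=> z; rewrite inE /h1 /= => /negP; rewrite -ltNge => /ltW ?; rewrite max_l.
  have mBD := measurableI _ _ mB mD.
  apply/eqP; rewrite eq_le; apply/andP; split.
    apply: le_integral => //.
    - exact: integrableS ih0.
    - exact: (finite_measure_integrable_cst Q 0).
    - by move=> z; rewrite inE => -[].
  by rewrite integral0 -h0E ?nu0.
(* Where [h1] is at least 1, its integral is at least the [Q]-mass and, being a value of [nu], at
   most that mass. Capping at 1 changes no set integral. *)
pose h2 z := mine (h1 z) 1%E.
have mh2 : measurable_fun [set: Z] h2 by exact: measurable_mine.
have h2E B : measurable B -> nu B = (\int[Q]_(z in B) h2 z)%E.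
  move=> mB; rewrite h1E//; apply/esym.
  have mD : measurable [set z | (1 <= h1 z)%E].
    by rewrite -[X in measurable X]setTI; exact: emeasurable_fun_c_infty.
  apply: (@eq_integral_patch _ _ _ Q h1 (cst 1%E) h2 [set z | (1 <= h1 z)%E]) => //.
  - by move=> z; rewrite inE /h2 /= => ?; rewrite min_r.
  - by move=> z; rewrite inE /h2 /= => /negP; rewrite -ltNge => /ltW ?; rewrite min_l.
  have mBD := measurableI _ _ mB mD.
  apply/eqP; rewrite eq_le; apply/andP; split.
    by rewrite -h1E// integral_cst// mul1e nu1.
  apply: ge0_le_integral => //.
  - exact: measurable_funTS.
  - by move=> z [].
have h2_01 z : (0 <= h2 z <= 1)%E.
  by rewrite /h2 /h1 le_min le_max lexx orbT/= lee01/= ge_min lexx orbT.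
have h2fin z : h2 z \is a fin_num.
  have /andP[h2_ge0 h2_le1] := h2_01 z.
  by rewrite ge0_fin_numE// (le_lt_trans h2_le1)// ltry.
have fine01 z : 0 <= fine (h2 z) <= 1.
  by have := h2_01 z; rewrite -(fineK (h2fin z)) !lee_fin.
have mfine : measurable_fun [set: Z] (fine \o h2).
  by apply: measurableT_comp => //; exact: fine_measurable.
exists (fine \o h2); split => //; split => //.
  apply: (integrable_bounded01 P (X := fine \o h2 \o psi)).
    exact: (measurableT_comp mfine mpsi).
  by move=> t; exact: fine01.
move=> B mB; rewrite -nuE h2E// /Q/= /distribution ge0_integral_pushforward//.
- by apply: eq_integral => t _ /=; rewrite fineK.
- exact: measurable_funTS.
- by move=> z _; have /andP[] := h2_01 z.
Qed.

Lemma cond_exp_ae (h : Z -> R) : is_cond_exp P f psi h ->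
  ae_eq P [set: T] (EFin \o (cond_exp P f psi \o psi)) (EFin \o (h \o psi)).
Proof.
move=> hP; apply: is_cond_exp_ae_unique => //.
by rewrite /cond_exp; apply: (xgetI _ hP).
Qed.

Lemma measurable_cond_exp : measurable_fun [set: Z] (cond_exp P f psi).
Proof.
have [h [hP _]] := exists_cond_exp01.
by have [] : is_cond_exp P f psi (cond_exp P f psi) by exact: (xgetI _ hP).
Qed.

(** By definition of a version, [f] and [h \o psi] are weights with equal masses on preimages under
    [psi]. Nonnegativity allows an unbounded [k], such as an exponential density. *)
Lemma cond_exp_pullout (h k : Z -> R) : is_cond_exp P f psi h ->
  (forall z, 0 <= h z) -> measurable_fun [set: Z] k -> (forall z, 0 <= k z) ->
  (\int[P]_t (k (psi t) * f t)%:E = \int[P]_t (k (psi t) * h (psi t))%:E)%E.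
Proof.
move=> [mh ih hE] h_ge0 mk k_ge0.
under eq_integral do rewrite EFinM.
under [RHS]eq_integral do rewrite EFinM.
apply: (@eq_integral_weight _ _ _ _ _ _ _ P P psi psi f (h \o psi) (EFin \o k)) => //.
- exact: measurableT_comp.
- by move=> t; have /andP[] := f01 t.
- by move=> t /=.
- by move=> B mB; rewrite [RHS]hE.
- exact/measurable_EFinP.
Qed.

End conditional_expectation_theory.

(** * Change of measure *)

Lemma sqrB_bounded01 (R : realDomainType) (a b : R) :
  0 <= a <= 1 -> 0 <= b <= 1 -> 0 <= (a - b) ^+ 2 <= 1.
Proof.
move=> /andP[a0 a1] /andP[b0 b1]; rewrite sqr_ge0 -subr_ge0 /=.
have -> : 1 - (a - b) ^+ 2 = (1 - (a - b)) * (1 + (a - b)) by ring.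
by apply: mulr_ge0; lra.
Qed.

Lemma eq_expectation_ae d (T : measurableType d) (R : realType)
    (P : probability T R) (X Y : T -> R) :
  measurable_fun [set: T] X -> measurable_fun [set: T] Y ->
  (\forall t \ae P, X t = Y t) -> ('E_P[X] = 'E_P[Y])%E.
Proof.
move=> mX mY XY; rewrite unlock; apply: ae_eq_integral => //.
- exact/measurable_EFinP.
- exact/measurable_EFinP.
- by apply: filterS XY => t -> _.
Qed.

Lemma eq_covariance_ae d (T : measurableType d) (R : realType)
    (P : probability T R) (X Y W : T -> R) :
  measurable_fun [set: T] X -> measurable_fun [set: T] Y ->
  measurable_fun [set: T] W ->
  (\forall t \ae P, X t = Y t) -> covariance P X W = covariance P Y W.
Proof.
move=> mX mY mW XY; rewrite covariance.unlock /= (eq_expectation_ae mX mY XY).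
apply: eq_expectation_ae.
- by apply: measurable_funM; apply: measurable_funB.
- by apply: measurable_funM; apply: measurable_funB.
- by apply: filterS XY => t /= XYt; rewrite /GRing.mul /= XYt.
Qed.

Section tilt.
Context d (T : measurableType d) (R : realType).
Variables (P P' : probability T R) (w : T -> R).
Hypothesis mw : measurable_fun [set: T] w.
Hypothesis w_ge0 : forall t, 0 <= w t.
Hypothesis P'E :
  forall A, measurable A -> (P' A = \int[P]_(t in A) (w t)%:E)%E.

(** The mean of [X] under [P'] is that of [X * w] under [P], and [w] has mean 1, so the difference
    is the mean of a product minus the product of means. *)
Lemma covariance_tilt (X : T -> R) :
  measurable_fun [set: T] X -> (forall t, 0 <= X t <= 1) ->
  ('E_P'[X] - 'E_P[X] = covariance P X w)%E.
Proof.
move=> mX X01.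
(* The total mass of [P'] also makes [w] integrable, and [w] dominates [X * w]. *)
have w1 : (\int[P]_t (w t)%:E = 1)%E by rewrite -P'E// probability_setT.
have iw : P.-integrable [set: T] (EFin \o w).
  apply/integrableP; split; first exact/measurable_EFinP.
  under eq_integral do rewrite /= ger0_norm//.
  by rewrite w1 ltry.
have iX := integrable_bounded01 P mX X01.
have iXw : P.-integrable [set: T] (EFin \o (X \* w)).
  apply: le_integrable iw => //.
    exact/measurable_EFinP/measurable_funM.
  move=> t _ /=; rewrite lee_fin normrM ler_piMl//.
  by have /andP[X0 X1] := X01 t; rewrite ger0_norm.
rewrite covarianceE; try exact/Lfun1_integrable.
rewrite expectation.unlock /= w1 mule1; congr (_ - _)%E.
rewrite (@integral_density _ _ _ P P' w)//; first exact/measurable_EFinP.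
by move=> t; rewrite lee_fin; have /andP[] := X01 t.
Qed.

End tilt.

Section conditional_expectation_tilt.
Context dT dZ (T : measurableType dT) (Z : measurableType dZ) (R : realType).
Variables (P P' : probability T R) (f : T -> R) (psi : T -> Z) (k : Z -> R).
Hypothesis mf : measurable_fun [set: T] f.
Hypothesis f01 : forall t, 0 <= f t <= 1.
Hypothesis mpsi : measurable_fun [set: T] psi.
Hypothesis mk : measurable_fun [set: Z] k.
Hypothesis k_ge0 : forall z, 0 <= k z.
Hypothesis P'E :
  forall A, measurable A -> (P' A = \int[P]_(t in A) (k (psi t))%:E)%E.

(** Over a preimage of [B], integrating under [P'] inserts the factor [k * \1_B] evaluated at [psi],
    and the pull-out property under [P] exchanges [f] and [h \o psi] against that factor. *)
Lemma is_cond_exp_tilt (h : Z -> R) : is_cond_exp P f psi h ->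
  (forall z, 0 <= h z <= 1) -> is_cond_exp P' f psi h.
Proof.
move=> hP h01; have [mh _ _] := hP; split => //.
  apply: (integrable_bounded01 P' (X := h \o psi)); first exact: measurableT_comp.
  by move=> t; exact: h01.
move=> B mB.
have mkpsi : measurable_fun [set: T] (k \o psi) by exact: measurableT_comp.
have mpB : measurable (psi @^-1` B).
  by rewrite -[X in measurable X]setTI; exact: mpsi.
have weighted (X : T -> R) : measurable_fun [set: T] X -> (forall t, 0 <= X t) ->
    (\int[P']_(t in psi @^-1` B) (X t)%:E =
     \int[P]_t ((k (psi t) * \1_B (psi t)) * X t)%:E)%E.
  move=> mX X_ge0; rewrite integral_mkcond.
  rewrite (@integral_density _ _ _ P P' (k \o psi)) => //.
  - apply: eq_integral => t _; rewrite patchE mulrAC EFinM muleC EFinM.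
    have -> : \1_B (psi t) = (t \in psi @^-1` B)%:R :> R by [].
    by case: ifPn => _; rewrite ?mule1 ?mule0 ?mul0e// muleC.
  - by move=> t; exact: k_ge0.
  - apply/(measurable_restrictT _ mpB).
    exact/measurable_EFinP/measurable_funTS.
  - by move=> t; rewrite patchE; case: ifPn => // _; rewrite lee_fin.
rewrite (weighted (h \o psi)); last 2 first.
- exact: measurableT_comp.
- by move=> t; have /andP[] := h01 (psi t).
rewrite weighted//; last by move=> t; have /andP[] := f01 t.
rewrite (@cond_exp_pullout _ _ _ _ _ P f psi mf f01 mpsi h (k \* \1_B))//.
- by move=> z; have /andP[] := h01 z.
- by apply: measurable_funM => //; exact: measurable_indic.
- by move=> z; rewrite mulr_ge0.
Qed.

(** The versions selected for [P] and [P'] may differ, but each agrees almost surely, under its own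
    law, with one common version [h] valued in [0, 1]. With [h] in place, the residual is a fixed
    bounded function and [covariance_tilt] applies. *)
Lemma cond_exp_residual_tilt :
  ('E_P'[fun t => ((f t - cond_exp P' f psi (psi t)) ^+ 2)%R] -
   'E_P[fun t => ((f t - cond_exp P f psi (psi t)) ^+ 2)%R] =
   covariance P (fun t => (f t - cond_exp P f psi (psi t)) ^+ 2)%R
     (k \o psi))%E.
Proof.
have [h [hP h01]] := exists_cond_exp01 P mf f01 mpsi.
have hP' := is_cond_exp_tilt hP h01.
have mres (g : Z -> R) : measurable_fun [set: Z] g ->
    measurable_fun [set: T] (fun t => (f t - g (psi t)) ^+ 2).
  move=> mg; apply: measurable_funX; apply: measurable_funB => //.
  exact: measurableT_comp.
have [mh _ _] := hP.
have mcP := measurable_cond_exp P mf f01 mpsi.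
have mcP' := measurable_cond_exp P' mf f01 mpsi.
have resP : \forall t \ae P, (f t - cond_exp P f psi (psi t)) ^+ 2 =
    (f t - h (psi t)) ^+ 2.
  by apply: filterS (cond_exp_ae mpsi hP) => t /(_ I)[] ->.
have resP' : \forall t \ae P', (f t - cond_exp P' f psi (psi t)) ^+ 2 =
    (f t - h (psi t)) ^+ 2.
  by apply: filterS (cond_exp_ae mpsi hP') => t /(_ I)[] ->.
rewrite (eq_expectation_ae _ _ resP') ?(eq_expectation_ae _ _ resP)//; try exact: mres.
rewrite (eq_covariance_ae _ _ _ resP); try exact: mres; last exact: measurableT_comp.
apply: covariance_tilt => //.
- exact: measurableT_comp.
- by move=> t; exact: k_ge0.
- exact: mres.
by move=> t; exact: sqrB_bounded01.
Qed.

End conditional_expectation_tilt.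

(** * Product kernels *)

(** Tonelli turns both sides into iterated integrals, where the densities are exchanged one factor
    at a time. *)
Lemma pprod_tilt d1 d2 (T1 : measurableType d1) (T2 : measurableType d2)
    (R : realType) (P1 P1' : probability T1 R) (P2 P2' : probability T2 R)
    (w1 : T1 -> R) (w2 : T2 -> R) :
  measurable_fun [set: T1] w1 -> measurable_fun [set: T2] w2 ->
  (forall x, 0 <= w1 x) -> (forall y, 0 <= w2 y) ->
  (forall A, measurable A -> P1' A = \int[P1]_(x in A) (w1 x)%:E)%E ->
  (forall A, measurable A -> P2' A = \int[P2]_(y in A) (w2 y)%:E)%E ->
  forall A, measurable A ->
    (pprod P1' P2' A = \int[pprod P1 P2]_(z in A) (w1 z.1 * w2 z.2)%:E)%E.
Proof.
move=> mw1 mw2 w1_ge0 w2_ge0 P1'E P2'E A mA.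
have mind : measurable_fun [set: T1 * T2] (EFin \o (\1_A : T1 * T2 -> R)).
  exact/measurable_EFinP/measurable_indic.
have ind_ge0 z : (0 <= (EFin \o (\1_A : T1 * T2 -> R)) z)%E by rewrite lee_fin.
rewrite -[A in LHS]setIT -integral_indic// [LHS]fubini_tonelli1//.
rewrite (@integral_density _ _ _ P1 P1' w1)//; last 2 first.
- exact: measurable_fun_fubini_tonelli_F.
- by move=> x; apply: integral_ge0.
rewrite [RHS]integral_mkcond.
have mw : measurable_fun [set: T1 * T2]
    (fun z => (\1_A z * (w1 z.1 * w2 z.2))%:E).
  apply/measurable_EFinP/measurable_funM; first exact: measurable_indic.
  by apply: measurable_funM; apply: measurableT_comp.
rewrite (eq_integral (fun z => (\1_A z * (w1 z.1 * w2 z.2))%:E)); last first.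
  by move=> z _; rewrite patchE indicE; case: ifPn; rewrite ?mul1r ?mul0r.
rewrite [RHS]fubini_tonelli1//; last first.
  by move=> z; rewrite lee_fin !mulr_ge0.
apply: eq_integral => x _; rewrite /fubini_F.
have mindx : measurable_fun [set: T2] (fun y => (EFin \o (\1_A : T1 * T2 -> R)) (x, y)).
  exact: measurableT_comp.
rewrite (@integral_density _ _ _ P2 P2' w2)//.
rewrite muleC -ge0_integralZl//; last 3 first.
- by apply: emeasurable_funM => //; exact/measurable_EFinP.
- by move=> y _; rewrite mule_ge0// lee_fin.
- by rewrite lee_fin.
by apply: eq_integral => y _ /=; rewrite -!EFinM mulrCA.
Qed.

Section kernel_fst.
Context dX dT dY (X : measurableType dX) (T : measurableType dT)
  (Y : measurableType dY) (R : realType).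
Variable K : R.-pker X ~> Y.

(** Lets the second factor of a product be drawn after the first, without depending on it. *)
Definition kernel_fst (z : X * T) : {measure set Y -> \bar R} := K z.1.

Let measurable_kernel_fst U : measurable U ->
  measurable_fun [set: X * T] (kernel_fst ^~ U).
Proof.
move=> mU; apply: (measurableT_comp (f := fun x => K x U)) => //.
exact: measurable_kernel.
Qed.

HB.instance Definition _ :=
  isKernel.Build _ _ (X * T)%type Y R kernel_fst measurable_kernel_fst.

HB.instance Definition _ := Kernel_isProbability.Build _ _ _ _ _
  kernel_fst (fun z => prob_kernel z.1).

End kernel_fst.

Section kernel_product.
Context dX d1 d2 (X : measurableType dX) (T1 : measurableType d1)
  (T2 : measurableType d2) (R : realType).
Variables (K1 : R.-pker X ~> T1) (K2 : R.-pker X ~> T2).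

(** The construction behind [fiber2] and [fiber3], packaged as a kernel to obtain measurability in
    the prompt. *)
Definition kernel_product (x : X) : {measure set (T1 * T2) -> \bar R} :=
  pprod (fiber K1 x) (fiber K2 x).

Let measurable_kernel_product U : measurable U ->
  measurable_fun [set: X] (kernel_product ^~ U).
Proof.
move=> mU.
(* The section of [V] at [(x, y)] is the section of [U] at [y]; its [K2]-mass is then integrated
   against [K1]. *)
pose V := [set z : X * T1 * T2 | U (z.1.2, z.2)].
have mV : measurable V.
  have mf : measurable_fun [set: X * T1 * T2] (fun z => (z.1.2, z.2)).
    apply: measurable_fun_pair => //.
    exact: (measurableT_comp measurable_snd measurable_fst).
  by have := mf measurableT U mU; rewrite setTI.
have mk : measurable_fun [set: X * T1]
    (fun z => kernel_fst K2 z (xsection V z)).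
  by apply: measurable_fun_xsection_finite_kernel; rewrite inE.
exact: (measurable_fun_integral_finite_kernel _ K1 (fun=> measure_ge0 _ _) mk).
Qed.

HB.instance Definition _ :=
  isKernel.Build _ _ X (T1 * T2)%type R kernel_product measurable_kernel_product.

HB.instance Definition _ := Kernel_isProbability.Build _ _ _ _ _
  kernel_product (fun x => probability_setT (pprod (fiber K1 x) (fiber K2 x))).

End kernel_product.

(** * A countable dense family of functions *)

Section generated_algebra.
Context (I : countType) d (Z : measurableType d) (G : I -> set Z).
Hypothesis mG : forall i, measurable (G i).

(* The trees enumerate the algebra of sets generated by [G]: a node denotes the
   complement of the union of its children. *)
Fixpoint nor_mem (z : Z) (t : GenTree.tree I) : bool :=
  match t with
  | GenTree.Leaf i => `[< G i z >]
  | GenTree.Node _ s => ~~ has (nor_mem z) s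
  end.

Definition nor_set (t : GenTree.tree I) : set Z := [set z | nor_mem z t].

Lemma measurable_nor_set t : measurable (nor_set t).
Proof.
move: t; fix IH 1 => -[i|n s].
  rewrite (_ : nor_set _ = G i); first exact: mG.
  by apply/seteqP; split => z /asboolP.
have -> : nor_set (GenTree.Node n s) = ~` [set z | has (nor_mem z) s].
  by apply/seteqP; split => z /negP.
apply: measurableC; elim: s => [|t s IHs] /=.
  by rewrite (_ : mkset _ = set0)//; apply/seteqP; split.
rewrite (_ : mkset _ = nor_set t `|` [set z | has (nor_mem z) s]).
  by apply: measurableU.
by apply/seteqP; split => z /orP.
Qed.

Lemma nor_setC n t : nor_set (GenTree.Node n [:: t]) = ~` nor_set t.
Proof. by apply/seteqP; split => z; rewrite /nor_set /= orbF => /negP. Qed.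

Lemma nor_set_bigsetU n p (t : nat -> GenTree.tree I) (m : nat) :
  nor_set (GenTree.Node n [:: GenTree.Node p [seq t k | k <- iota 0 m]]) =
  \big[setU/set0]_(k < m) nor_set (t k).
Proof.
rewrite nor_setC -(bigcup_mkord m (fun k => nor_set (t k))); apply/seteqP; split => z.
  move=> /= /negP; rewrite negbK => /hasP[_ /mapP[k km ->] zk].
  by exists k => //=; move: km; rewrite mem_iota.
move=> [k /= km zk] /negP; apply; apply/hasP; exists (t k) => //.
by apply/mapP; exists k => //; rewrite mem_iota.
Qed.

(** Good-sets argument: the measurable sets approximable in [Q]-measure contain the generators and
    form a sigma-algebra. *)
Lemma approx_nor_set (R : realType) (Q : probability Z R) (A : set Z) (e : R) :
  <<s range G >> A -> 0 < e ->
  exists t, (Q (A `+` nor_set t) < e%:E)%E.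
Proof.
pose C : set_system Z := [set A | measurable A /\
  forall e : R, 0 < e -> exists t, (Q (A `+` nor_set t) < e%:E)%E].
suff sC : sigma_algebra [set: Z] C.
  move=> GA e0; have : C A; last by case=> _; exact.
  move: A GA {e e0}; apply: smallest_sub => // _ [i _ <-]; split => // e e0.
  exists (GenTree.Leaf i); rewrite (_ : nor_set _ = G i) ?setYK ?measure0//.
  by apply/seteqP; split => z /asboolP.
split.
(* A childless node denotes the whole space, so its complement is empty. *)
- split => // e0 e0_gt0; exists (GenTree.Node 0 [:: GenTree.Node 0 [::]]).
  have -> : nor_set (GenTree.Node 0 [:: GenTree.Node 0 [::]]) = set0.
    by apply/seteqP; split.
  by rewrite setY0 measure0.
- move=> B [mB appB]; split; first by rewrite setTD; exact: measurableC.
  move=> e0 /appB[t Bt]; exists (GenTree.Node 0 [:: t]); rewrite nor_setC setTD.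
  suff -> : ~` B `+` ~` nor_set t = B `+` nor_set t by [].
  apply/seteqP; split => z /=.
    by move=> [[? /contrapT ?]|[? /contrapT ?]]; [right|left].
  by move=> [[? ?]|[? ?]]; [right|left]; split => //; exact.
move=> B CB.
have mB k : measurable (B k) by have [] := CB k.
have mU : measurable (\bigcup_k B k) by exact: bigcupT_measurable.
split=> // e0 e0_gt0.
pose F n := \big[setU/set0]_(k < n) B k.
have mF n : measurable (F n) by apply: bigsetU_measurable.
(* The remainders decrease to the empty set; continuity from above makes one of them small. *)
have [N QN] : exists N, (Q (\bigcup_k B k `\` F N) < (e0 / 2)%:E)%E.
  pose D n := \bigcup_k B k `\` F n.
  have mD n : measurable (D n) by exact: measurableD.
  have D0 : \bigcap_n D n = set0.
    rewrite /D -subset0 => z zD.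
    have [[k _ Bkz] _] := zD 0%N Logic.I.
    have [_] := zD k.+1 Logic.I; apply.
    by rewrite /F -bigcup_mkord; exists k => /=.
  have : (Q \o D) n @[n --> \oo] --> Q (\bigcap_n D n).
    apply: nonincreasing_cvg_mu => //.
    - by rewrite -ge0_fin_numE// fin_num_measure.
    - by rewrite D0.
    - apply/nonincreasing_seqP => n; apply/subsetPset; apply: setDS.
      by rewrite /F big_ord_recr/=; exact: subsetUl.
  rewrite D0 measure0 => /fine_cvgP[_] /cvgrPdist_lt/(_ (e0 / 2)).
  rewrite divr_gt0// => /(_ isT)[N _ /(_ N (leqnn N))]/=.
  rewrite sub0r normrN ger0_norm ?fine_ge0// => QN.
  by exists N; rewrite -(@fineK _ (Q _)) ?lte_fin// fin_num_measure//; exact: mD.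
(* The other half of the error is shared by the first [N] sets; dividing by [N.+1] keeps the share
   defined when [N] is 0. *)
have eN_gt0 : 0 < e0 / 2 / N.+1%:R by rewrite !divr_gt0.
have /choice[t Bt] : forall k, exists t,
    (Q (B k `+` nor_set t) < (e0 / 2 / N.+1%:R)%:E)%E.
  by move=> k; have [_ /(_ _ eN_gt0)] := CB k.
exists (GenTree.Node 0 [:: GenTree.Node 0 [seq t k | k <- iota 0 N]]).
rewrite nor_set_bigsetU.
have mY k : measurable (B k `+` nor_set (t k)).
  by apply: measurableU; apply: measurableD => //; exact: measurable_nor_set.
have mUY : measurable (\big[setU/set0]_(k < N) (B k `+` nor_set (t k))).
  exact: bigsetU_measurable.
apply: (@le_lt_trans _ _ (Q ((\bigcup_k B k `\` F N) `|`
    \big[setU/set0]_(k < N) (B k `+` nor_set (t k))))%E).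
  apply: le_measure; rewrite ?inE.
  - apply: measurableU; apply: measurableD => //; apply: bigsetU_measurable => k _;
    exact: measurable_nor_set.
  - by apply: measurableU => //; exact: measurableD.
  rewrite /F -bigcup_mkord -(bigcup_mkord N (fun k => nor_set (t k)))
    -(bigcup_mkord N (fun k => B k `+` nor_set (t k))) => z.
  move=> [[[k _ Bkz] nz]|[[k /= kN tkz] nz]].
    have [zF|zF] := pselect ((\bigcup_(k < N) B k) z).
      right; have [j jN Bjz] := zF; exists j => //; left; split => //.
      by move=> tjz; apply: nz; exists j.
    by left; split => //; exists k.
  right; exists k => //; right; split => //.
  by move=> Bkz; apply: nz; exists k.
apply: (le_lt_trans (measureU2 Q (measurableD mU (mF N)) mUY)).
rewrite (splitr e0) EFinD lte_leD//.
  by rewrite fin_num_measure.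
apply: (le_trans (Boole_inequality Q (n := N) (fun k _ => mY k))).
apply: (@le_trans _ _ (\sum_(k < N) (e0 / 2 / N.+1%:R)%:E)%E).
  by apply: lee_sum => k _; exact/ltW/Bt.
rewrite sumEFin lee_fin sumr_const card_ord -[leLHS]mulr_natr mulrAC ler_pdivrMr//.
by rewrite ler_wpM2l ?ler_nat// divr_ge0// ltW.
Qed.

End generated_algebra.

(** The sum counts the positive integers up to [m] that do not exceed [x], so it is the integer part
    of [x]. *)
Lemma staircase_bounds (R : realDomainType) (m : nat) (x : R) :
  0 <= x <= m%:R ->
  0 <= x - \sum_(j < m) ((j.+1%:R : R) <= x)%R%:R <= 1.
Proof.
elim: m => [|m IHm] /andP[x0 xm]; first by rewrite big_ord0 subr0; lra.
rewrite big_ord_recr /=; have [xlem|mltx] := leP x m%:R.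
  have /negbTE -> : ~~ (m.+1%:R <= x).
    by rewrite -ltNge (le_lt_trans xlem)// ltr_nat.
  by rewrite addr0 IHm// x0.
rewrite (eq_bigr (fun=> 1)) => [|j _]; last first.
  suff -> : j.+1%:R <= x by [].
  by apply: (le_trans _ (ltW mltx)); rewrite ler_nat.
rewrite sumr_const card_ord.
have [xge|xlt] := leP m.+1%:R x.
  have -> : x = m.+1%:R by apply/eqP; rewrite eq_le xm.
  by rewrite -natrD addn1 subrr lexx ler01.
by move: xm; rewrite addr0 -natr1; lra.
Qed.

Section density.
Context (I : countType) d (Z : measurableType d) (G : I -> set Z).
Hypothesis mG : forall i, measurable (G i).
Variable R : realType.

(** Finite lists over a countable type are countable, hence so is this family. The empty list gives
    the zero function, as [0^-1 = 0]. *)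
Definition nor_avg (s : seq (GenTree.tree I)) (z : Z) : R :=
  (size s)%:R^-1 * \sum_(t <- s) \1_(nor_set G t) z.

Lemma measurable_nor_avg s : measurable_fun [set: Z] (nor_avg s).
Proof.
apply: measurable_funM => //; apply: measurable_sum => t.
exact/measurable_indic/measurable_nor_set.
Qed.

Lemma nor_avg_bounded01 s z : 0 <= nor_avg s z <= 1.
Proof.
apply/andP; split.
  by rewrite mulr_ge0 ?invr_ge0// sumr_ge0// => t _; rewrite indicE.
rewrite /nor_avg; have [->|s0] := eqVneq (size s) 0%N.
  by rewrite invr0 mul0r.
rewrite mulrC ler_pdivrMr ?ltr0n ?lt0n// mul1r.
apply: (@le_trans _ _ (\sum_(t <- s) 1)).
  by apply: ler_sum => t _; rewrite indicE; case: (_ \in _).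
by rewrite big_const_seq count_predT iter_addr addr0.
Qed.

Hypothesis genG : forall A, measurable A -> <<s range G >> A.

(** Discrete layer-cake: the average of the indicators of the superlevel sets of [h] at heights
    (j+1)/m is within 1/m of [h], and each superlevel set is approximated by some [nor_set]. *)
Lemma approx_nor_avg (Q : probability Z R) (h : Z -> R) (e : R) :
  measurable_fun [set: Z] h -> (forall z, 0 <= h z <= 1) -> 0 < e ->
  exists s, (\int[Q]_z `|h z - nor_avg s z|%:E <= e%:E)%E.
Proof.
move=> mh h01 e_gt0.
(* This makes 1/m at most [e / 2]; the other half pays for approximating the superlevel sets. *)
pose m := (Num.truncn (2 / e)).+1.
have m_gt0 : 0 < m%:R :> R by rewrite ltr0n.
have mV : m%:R^-1 <= e / 2.
  rewrite invf_ple ?posrE ?divr_gt0// invf_div.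
  by rewrite ltW// truncnS_gt.
pose A (j : nat) := [set z | j.+1%:R <= m%:R * h z].
have mA j : measurable (A j).
  rewrite -[X in measurable X]setTI; apply: measurable_fun_le => //.
  exact: measurable_funM.
have e2_gt0 : 0 < e / 2 by rewrite divr_gt0.
have /choice[t At] : forall j, exists t, (Q (A j `+` nor_set G t) < (e / 2)%:E)%E.
  by move=> j; apply: approx_nor_set => //; exact: genG.
exists [seq t j | j <- iota 0 m].
have mY j : measurable (A j `+` nor_set G (t j)).
  by apply: measurableU; apply: measurableD => //; exact: measurable_nor_set.
have bound z : `|h z - nor_avg [seq t j | j <- iota 0 m] z| <=
    m%:R^-1 + m%:R^-1 * \sum_(j < m) \1_(A j `+` nor_set G (t j)) z.
  rewrite /nor_avg size_map size_iota big_map -[iota 0 m]/(index_iota 0 m) big_mkord.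
  have /andP[s0 s1] : 0 <= m%:R * h z - \sum_(j < m) \1_(A j) z <= 1.
    have := @staircase_bounds R m (m%:R * h z).
    rewrite (eq_bigr (fun j : 'I_m => \1_(A j) z)) => [|j _]; last first.
      by rewrite indicE; congr (nat_of_bool _)%:R; apply/idP/idP; rewrite inE.
    apply; have /andP[hz0 hz1] := h01 z.
    by rewrite mulr_ge0//= ler_piMr.
  have -> : h z - m%:R^-1 * \sum_(j < m) \1_(nor_set G (t j)) z =
      m%:R^-1 * ((m%:R * h z - \sum_(j < m) \1_(A j) z) +
        \sum_(j < m) (\1_(A j) z - \1_(nor_set G (t j)) z)).
    by rewrite sumrB; field; rewrite gt_eqF.
  rewrite normrM ger0_norm ?invr_ge0// -[X in _ <= X + _]mulr1 -[leRHS]mulrDr.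
  rewrite ler_wpM2l ?invr_ge0//.
  apply: (le_trans (ler_normD _ _)); apply: lerD; first by rewrite ger0_norm.
  (* Two indicators differ by at most the indicator of the symmetric difference. *)
  apply: (le_trans (ler_norm_sum _ _ _)); apply: ler_sum => j _.
  rewrite !indicE in_setU !in_setD.
  by do 2 case: (_ \in _); rewrite /= ?subrr ?subr0 ?sub0r ?normrN ?normr0 ?normr1.
have mind (j : nat) : measurable_fun [set: Z]
    (fun z => (\1_(A j `+` nor_set G (t j)) z)%:E : \bar R).
  exact/measurable_EFinP/measurable_indic.
have msum : measurable_fun [set: Z]
    (fun z => (\sum_(j < m) (\1_(A j `+` nor_set G (t j)) z)%:E)%E : \bar R).
  exact: emeasurable_sum.
apply: (@le_trans _ _ (\int[Q]_z ((m%:R^-1)%:E + (m%:R^-1)%:E *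
    \sum_(j < m) (\1_(A j `+` nor_set G (t j)) z)%:E))%E).
  apply: ge0_le_integral => //.
  - apply/measurable_EFinP/measurableT_comp => //.
    by apply: measurable_funB => //; exact: measurable_nor_avg.
  - by apply: emeasurable_funD => //; exact: measurable_funeM.
  - by move=> z _; rewrite sumEFin -EFinM -EFinD lee_fin bound.
rewrite ge0_integralD//; last 2 first.
- by move=> z _; rewrite mule_ge0 ?lee_fin ?invr_ge0// sume_ge0.
- exact: measurable_funeM.
rewrite integral_cst// [X in (_ * X)%E](probability_setT Q) mule1.
rewrite ge0_integralZl//; last first.
  by move=> z _; rewrite sume_ge0.
rewrite ge0_integral_sum//.
under eq_bigr do rewrite integral_indic// setIT.
(* Since the errors of the [m] sets are averaged, the bound [e / 2] on each suffices whatever [m]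
   is. *)
apply: (@le_trans _ _ ((e / 2)%:E + (m%:R^-1)%:E * \sum_(j < m) (e / 2)%:E)%E).
  apply: leeD; first by rewrite lee_fin.
  apply: lee_wpmul2l; first by rewrite lee_fin invr_ge0.
  by apply: lee_sum => j _; exact/ltW/At.
rewrite sumEFin -EFinM -EFinD lee_fin sumr_const card_ord -(mulr_natl (e / 2) m).
by rewrite mulKf ?gt_eqF// -splitr.
Qed.

End density.

(** * Countable generators for pairs of embedding vectors *)

Section tuple_pair_generator.
Variables (R : realType) (d : nat).

(** The boolean selects the member of the pair; rational thresholds keep the index type
    countable. *)
Definition ray (i : bool * 'I_d * rat) : set (d.-tuple R * d.-tuple R) :=
  [set z | ratr i.2 < tnth (if i.1.1 then z.1 else z.2) i.1.2].

Lemma measurable_ray i : measurable (ray i).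
Proof.
have mf : measurable_fun [set: d.-tuple R * d.-tuple R]
    (fun z => tnth (if i.1.1 then z.1 else z.2) i.1.2).
  apply: (measurableT_comp (f := fun s : d.-tuple R => tnth s i.1.2)).
    exact: measurable_tnth.
  by case: (i.1.1); [exact: measurable_fst|exact: measurable_snd].
have := mf measurableT `]ratr i.2, +oo[%classic (measurable_itv _).
rewrite setTI; congr measurable; apply/seteqP; split => z /=;
by rewrite in_itv/= andbT.
Qed.

(** It suffices that the identity be measurable from the sigma-algebra generated by the rays, which
    is checked on each real coordinate. *)
Lemma ray_generates (A : set (d.-tuple R * d.-tuple R)) :
  measurable A -> <<s range ray >> A.
Proof.
move=> mA.
pose TT : measurableType _ := (d.-tuple R * d.-tuple R)%type.
pose Z : measurableType _ := @g_sigma_algebraType (TT : pointedType) (range ray).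
suff mid : @measurable_fun _ _ Z (d.-tuple R * d.-tuple R)%type [set: Z] id.
  by have := mid measurableT A mA; rewrite setTI.
have coord (b : bool) (i : 'I_d) : @measurable_fun _ _ Z R [set: Z]
    (fun z => tnth (if b then z.1 else z.2) i).
  apply: (measurability _ (RGenOInfty.measurableE R)) => _ [_ [x ->] <-].
  (* A ray with real threshold [x] is the countable union of the rays with rational threshold above
     [x]. *)
  rewrite setTI (_ : _ @^-1` _ =
    \bigcup_(q : rat) (if x < ratr q then ray (b, i, q) else set0)).
    apply: bigcupT_measurable_rat => q; case: ifPn => // _.
    by apply: sub_sigma_algebra; exists (b, i, q).
  apply/seteqP; split => z /=.
    rewrite in_itv/= andbT => /rat_in_itvoo[q]; rewrite in_itv/= => /andP[xq qz].
    by exists q => //; rewrite xq.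
  move=> [q _]; case: ifPn => // xq qz; rewrite in_itv/= andbT.
  exact: lt_trans qz.
have -> : (id : Z -> d.-tuple R * d.-tuple R) = fun z => (z.1, z.2).
  by apply/funext => -[].
apply: (@measurable_fun_pair _ _ _ Z); apply/(@measurable_fun_tnthP _ _ Z) => i.
- exact: (coord true).
- exact: (coord false).
Qed.

End tuple_pair_generator.

(** * Mean squared residuals *)

Section residual_variational.
Context dT dZ (T : measurableType dT) (Z : measurableType dZ) (R : realType).
Variables (P : probability T R) (f : T -> R) (psi : T -> Z).
Hypothesis mf : measurable_fun [set: T] f.
Hypothesis f01 : forall t, 0 <= f t <= 1.
Hypothesis mpsi : measurable_fun [set: T] psi.

Let f_ge0 t : 0 <= f t. Proof. by have /andP[] := f01 t. Qed.

Let integralD0 (X Y : T -> R) :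
  measurable_fun [set: T] X -> measurable_fun [set: T] Y ->
  (forall t, 0 <= X t) -> (forall t, 0 <= Y t) ->
  (\int[P]_t (X t + Y t)%:E = \int[P]_t (X t)%:E + \int[P]_t (Y t)%:E)%E.
Proof.
move=> mX mY X0 Y0; under eq_integral do rewrite EFinD.
by rewrite ge0_integralD//; try exact/measurable_EFinP;
  move=> t _; rewrite lee_fin.
Qed.

Let le_integral0 (X Y : T -> R) :
  measurable_fun [set: T] X -> measurable_fun [set: T] Y ->
  (forall t, 0 <= X t) -> (forall t, X t <= Y t) ->
  (\int[P]_t (X t)%:E <= \int[P]_t (Y t)%:E)%E.
Proof.
move=> mX mY X0 XY; apply: ge0_le_integral => //; try exact/measurable_EFinP.
- by move=> t _; rewrite lee_fin.
- by move=> t _; rewrite lee_fin.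
Qed.

(** Least-squares projection: after pulling out the cross terms, the two sides differ by the mean of
    the square of [h - q] along [psi]. *)
Lemma residual_le (h q : Z -> R) : is_cond_exp P f psi h ->
  (forall z, 0 <= h z <= 1) ->
  measurable_fun [set: Z] q -> (forall z, 0 <= q z <= 1) ->
  (\int[P]_t ((f t - h (psi t)) ^+ 2)%:E <=
   \int[P]_t ((f t - q (psi t)) ^+ 2)%:E)%E.
Proof.
move=> hP h01 mq q01; have [mh _ _] := hP.
have h_ge0 z : 0 <= h z by have /andP[] := h01 z.
have q_ge0 z : 0 <= q z by have /andP[] := q01 z.
pose F t := f t; pose H t := h (psi t); pose K t := q (psi t).
have mH : measurable_fun [set: T] H by exact: measurableT_comp.
have mK : measurable_fun [set: T] K by exact: measurableT_comp.
have mF : measurable_fun [set: T] F by [].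
have mM (X Y : T -> R) : measurable_fun [set: T] X -> measurable_fun [set: T] Y ->
    measurable_fun [set: T] (fun t => X t * Y t) by move=> ? ?; exact: measurable_funM.
have mD (X Y : T -> R) : measurable_fun [set: T] X -> measurable_fun [set: T] Y ->
    measurable_fun [set: T] (fun t => X t + Y t) by move=> ? ?; exact: measurable_funD.
have mB (X Y : T -> R) : measurable_fun [set: T] X -> measurable_fun [set: T] Y ->
    measurable_fun [set: T] (fun t => (X t - Y t) ^+ 2).
  by move=> ? ?; apply: measurable_funX; exact: measurable_funB.
have F0 t : 0 <= F t by exact: f_ge0.
have H0 t : 0 <= H t by exact: h_ge0.
have K0 t : 0 <= K t by exact: q_ge0.
have M0 (X Y : T -> R) : (forall t, 0 <= X t) -> (forall t, 0 <= Y t) ->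
  forall t, 0 <= X t * Y t by move=> X0 Y0 t; exact: mulr_ge0.
have pull (k : Z -> R) : measurable_fun [set: Z] k -> (forall z, 0 <= k z) ->
    (\int[P]_t (k (psi t) * F t)%:E = \int[P]_t (k (psi t) * H t)%:E)%E.
  by move=> mk k_ge0; exact: (cond_exp_pullout mf f01 mpsi hP h_ge0 mk k_ge0).
have pullK : (\int[P]_t (2 * K t * F t)%:E = \int[P]_t (2 * K t * H t)%:E)%E.
  apply: (pull (fun z => 2 * q z)); first exact: measurable_funM.
  by move=> z; exact: mulr_ge0.
have pullH : (\int[P]_t (2 * H t * F t)%:E = \int[P]_t (2 * H t * H t)%:E)%E.
  apply: (pull (fun z => 2 * h z)); first exact: measurable_funM.
  by move=> z; exact: mulr_ge0.
(* Bounded by 3, since [H] and [K] lie in [0, 1]; its finite integral can later be cancelled in the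
   extended reals. *)
have iKH : P.-integrable [set: T] (fun t => (2 * K t * H t + H t * H t)%:E).
  have : P.-integrable [set: T] (EFin \o cst 3) by exact: finite_measure_integrable_cst.
  apply: le_integrable => //.
    apply/measurable_EFinP; apply: (mD (fun t => 2 * K t * H t)).
      by apply: (mM) => //; exact: mM.
    exact: mM.
  move=> t _ /=; rewrite lee_fin !ger0_norm ?addr_ge0 ?mulr_ge0//.
  have /andP[h0 h1] := h01 (psi t); have /andP[k0 k1] := q01 (psi t).
  by rewrite /K /H; nra.
(* Orthogonality of [f - h o psi] to functions of [psi], arranged so that only
   integrals of nonnegative functions occur. *)
have expand : (\int[P]_t ((F t - K t) ^+ 2)%:E +
    \int[P]_t (2 * K t * H t + H t * H t)%:E =
    \int[P]_t ((F t - H t) ^+ 2)%:E +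
    \int[P]_t (2 * H t * H t + K t * K t)%:E)%E.
  have mKH (X : T -> R) : measurable_fun [set: T] X ->
      measurable_fun [set: T] (fun t => 2 * K t * X t).
    by move=> mX; apply: (mM) => //; exact: mM.
  have mHH (X : T -> R) : measurable_fun [set: T] X ->
      measurable_fun [set: T] (fun t => 2 * H t * X t).
    by move=> mX; apply: (mM) => //; exact: mM.
  have KH0 (X : T -> R) : (forall t, 0 <= X t) ->
      forall t, 0 <= 2 * K t * X t by move=> X0 t; rewrite !mulr_ge0.
  have HH0 (X : T -> R) : (forall t, 0 <= X t) ->
      forall t, 0 <= 2 * H t * X t by move=> X0 t; rewrite !mulr_ge0.
  rewrite [X in (_ + X = _)%E]integralD0;
    try by [exact: mKH|exact: mM|exact: KH0|exact: M0].
  rewrite [X in (_ = _ + X)%E]integralD0;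
    try by [exact: mHH|exact: mM|exact: HH0|exact: M0].
  rewrite -pullK -pullH -[X in (_ + X = _)%E]integralD0;
    try by [exact: mKH|exact: mM|exact: KH0|exact: M0].
  rewrite -[X in (_ = _ + X)%E]integralD0;
    try by [exact: mHH|exact: mM|exact: HH0|exact: M0].
  rewrite -!integralD0.
    by apply: eq_integral => t _; congr EFin; ring.
  - exact: mB.
  - by apply: (mD); [exact: mHH|exact: mM].
  - by move=> t; exact: sqr_ge0.
  - by move=> t; rewrite addr_ge0 ?HH0 ?M0.
  - exact: mB.
  - by apply: (mD); [exact: mKH|exact: mM].
  - by move=> t; exact: sqr_ge0.
  - by move=> t; rewrite addr_ge0 ?KH0 ?M0.
(* The integrands differ by the square of [H - K]. *)
have le12 : (\int[P]_t (2 * K t * H t + H t * H t)%:E <=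
    \int[P]_t (2 * H t * H t + K t * K t)%:E)%E.
  apply: le_integral0.
  - by apply: (mD); [apply: (mM) => //; exact: mM|exact: mM].
  - by apply: (mD); [apply: (mM) => //; exact: mM|exact: mM].
  - by move=> t; rewrite addr_ge0 ?mulr_ge0.
  - by move=> t; have := sqr_ge0 (H t - K t); nra.
have fin1 := integrable_fin_num measurableT iKH.
rewrite -(leeD2rE _ _ fin1) expand.
by apply: leeD.
Qed.

(** The difference of the squares factors as [(2 * f - q - h) * (h - q)], whose first factor has
    absolute value at most 2. Closeness in L1 thus controls the squared error. *)
Lemma residual_le_dist (h q : Z -> R) :
  measurable_fun [set: Z] h -> (forall z, 0 <= h z <= 1) ->
  measurable_fun [set: Z] q -> (forall z, 0 <= q z <= 1) ->
  (\int[P]_t ((f t - q (psi t)) ^+ 2)%:E <=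
   \int[P]_t ((f t - h (psi t)) ^+ 2)%:E +
   2%:E * \int[P]_t `|h (psi t) - q (psi t)|%:E)%E.
Proof.
move=> mh h01 mq q01.
have mhpsi : measurable_fun [set: T] (h \o psi) by exact: measurableT_comp.
have mqpsi : measurable_fun [set: T] (q \o psi) by exact: measurableT_comp.
have md : measurable_fun [set: T] (fun t => `|h (psi t) - q (psi t)|).
  by apply: measurableT_comp => //; exact: measurable_funB.
rewrite -ge0_integralZl//; last exact/measurable_EFinP.
under [X in (_ <= _ + X)%E]eq_integral do rewrite -EFinM.
rewrite -integralD0; first last.
- by move=> t; rewrite mulr_ge0.
- by move=> t; rewrite sqr_ge0.
- exact: measurable_funM.
- by apply: measurable_funX; exact: measurable_funB.
apply: le_integral0.
- by apply: measurable_funX; exact: measurable_funB.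
- apply: measurable_funD; last exact: measurable_funM.
  by apply: measurable_funX; exact: measurable_funB.
- by move=> t; rewrite sqr_ge0.
move=> t; have /andP[f0 f1] := f01 t.
have /andP[h0 h1] := h01 (psi t); have /andP[q0 q1] := q01 (psi t).
have -> : (f t - q (psi t)) ^+ 2 = (f t - h (psi t)) ^+ 2 +
    (2 * f t - q (psi t) - h (psi t)) * (h (psi t) - q (psi t)) by ring.
rewrite lerD2l; apply: (le_trans (ler_norm _)); rewrite normrM.
by rewrite ler_wpM2r// ler_norml; apply/andP; split; lra.
Qed.

End residual_variational.

(** The selected version may leave [0, 1] on a null set, so the bound is read off a version that
    stays in [0, 1] everywhere. *)
Lemma cond_exp_residual_le1 dT dZ (T : measurableType dT)
    (Z : measurableType dZ) (R : realType) (P : probability T R) (f : T -> R)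
    (psi : T -> Z) :
  measurable_fun [set: T] f -> (forall t, 0 <= f t <= 1) ->
  measurable_fun [set: T] psi ->
  ('E_P[fun t => ((f t - cond_exp P f psi (psi t)) ^+ 2)%R] <= 1)%E.
Proof.
move=> mf f01 mpsi; have [h [hP h01]] := exists_cond_exp01 P mf f01 mpsi.
have [mh _ _] := hP.
have mres (q : Z -> R) : measurable_fun [set: Z] q ->
    measurable_fun [set: T] (fun t => (f t - q (psi t)) ^+ 2).
  move=> mq; apply: measurable_funX; apply: measurable_funB => //.
  exact: measurableT_comp.
rewrite (@eq_expectation_ae _ _ _ _ _ (fun t => (f t - h (psi t)) ^+ 2)).
- rewrite -(expectation_cst P 1); apply: expectation_le => //.
  + exact: mres.
  + by move=> t; exact: sqr_ge0.
  + by apply: aeW => t; have /andP[] := sqrB_bounded01 (f01 t) (h01 (psi t)).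
- exact/mres/measurable_cond_exp.
- exact: mres.
- by apply: filterS (cond_exp_ae mpsi hP) => t /(_ Logic.I)[] ->.
Qed.

Section residual_measurable.
Context dX dT dZ (X : measurableType dX) (T : measurableType dT)
  (Z : measurableType dZ) (R : realType).
Context (I : countType) (G : I -> set Z).
Hypothesis mG : forall i, measurable (G i).
Hypothesis genG : forall A, measurable A -> <<s range G >> A.

(** Every [nor_avg] competes in [residual_le], and by density some of them come arbitrarily close to
    the minimum. Codes that decode to no list default to the empty list, itself an admissible
    competitor. *)
Lemma cond_exp_residual_einfs (P : probability T R) (f : T -> R)
    (psi : T -> Z) :
  measurable_fun [set: T] f -> (forall t, 0 <= f t <= 1) ->
  measurable_fun [set: T] psi ->
  ('E_P[fun t => ((f t - cond_exp P f psi (psi t)) ^+ 2)%R] =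
   einfs (fun n => \int[P]_t
     ((f t - nor_avg G R (odflt [::] (unpickle n)) (psi t)) ^+ 2)%:E) 0%N)%E.
Proof.
move=> mf f01 mpsi; have [h [hP h01]] := exists_cond_exp01 P mf f01 mpsi.
have [mh _ _] := hP.
have mres (q : Z -> R) : measurable_fun [set: Z] q ->
    measurable_fun [set: T] (fun t => (f t - q (psi t)) ^+ 2).
  move=> mq; apply: measurable_funX; apply: measurable_funB => //.
  exact: measurableT_comp.
rewrite (@eq_expectation_ae _ _ _ _ _ (fun t => (f t - h (psi t)) ^+ 2)); last 3 first.
- exact/mres/measurable_cond_exp.
- exact: mres.
- by apply: filterS (cond_exp_ae mpsi hP) => t /(_ Logic.I)[] ->.
rewrite unlock; apply/eqP; rewrite eq_le; apply/andP; split.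
  apply: le_ereal_inf_tmp => _ [n _ <-].
  apply: residual_le => //; first exact: measurable_nor_avg.
  exact: nor_avg_bounded01.
apply/lee_addgt0Pr => e e_gt0.
pose mpsi' := isMeasurableFun.Build _ _ _ _ psi mpsi.
pose Psi : {mfun T >-> Z} := HB.pack psi mpsi'.
(* Half of [e] offsets the factor 2 of [residual_le_dist]; the approximation is in L1 of the law of
   [psi]. *)
have e2_gt0 : 0 < e / 2 by rewrite divr_gt0.
have [s hs] := approx_nor_avg mG genG (distribution P Psi) mh h01 e2_gt0.
apply: (@le_trans _ _ (\int[P]_t ((f t - nor_avg G R s (psi t)) ^+ 2)%:E)%E).
  by apply: ereal_inf_lbound; exists (pickle s) => //; rewrite pickleK.
rewrite ge0_integral_distribution// in hs; last first.
  apply/measurable_EFinP/measurableT_comp => //.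
  by apply: measurable_funB => //; exact: measurable_nor_avg.
have mq := measurable_nor_avg mG (R := R) s.
have q01 := nor_avg_bounded01 G R s.
apply: (le_trans (residual_le_dist P mf f01 mpsi mh h01 mq q01)).
apply: leeD => //; rewrite (_ : e%:E = 2%:E * (e / 2)%:E)%E.
  by apply: lee_wpmul2l.
by rewrite -EFinM mulrC divfK.
Qed.

(* The version selected by [cond_exp] need not be jointly measurable in the
   parameter [x], but its mean squared residual is an infimum over a countable
   family of functions of [psi] that does not depend on [x]. *)
Lemma measurable_cond_exp_residual (P : X -> probability T R)
    (f : X * T -> R) (psi : X * T -> Z) :
  (forall F : X * T -> \bar R, measurable_fun [set: X * T] F ->
    (forall z, 0 <= F z)%E ->
    measurable_fun [set: X] (fun x => \int[P x]_t F (x, t))%E) ->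
  measurable_fun [set: X * T] f -> (forall z, 0 <= f z <= 1) ->
  measurable_fun [set: X * T] psi ->
  measurable_fun [set: X] (fun x => 'E_(P x)[fun t =>
    ((f (x, t) - cond_exp (P x) (fun t => f (x, t)) (fun t => psi (x, t))
        (psi (x, t))) ^+ 2)%R])%E.
Proof.
move=> mP mf f01 mpsi.
under eq_fun => x.
  rewrite (@cond_exp_residual_einfs (P x) (fun t => f (x, t))
    (fun t => psi (x, t))); last 3 first.
  - exact: measurableT_comp.
  - by move=> t; exact: f01.
  - exact: measurableT_comp.
  over.
apply: (measurable_fun_einfs (f := fun n x => (\int[P x]_t ((f (x, t) -
  nor_avg G R (odflt [::] (unpickle n)) (psi (x, t))) ^+ 2)%:E)%E)) => n.
apply: (mP (fun z => ((f z -
  nor_avg G R (odflt [::] (unpickle n)) (psi z)) ^+ 2)%:E)).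
  apply/measurable_EFinP/measurable_funX/measurable_funB => //.
  apply: measurableT_comp => //; exact: measurable_nor_avg.
by move=> z; rewrite lee_fin sqr_ge0.
Qed.

End residual_measurable.

(** * One round of the update *)

Section preferences.
Context dX dY (X : measurableType dX) (Y : measurableType dY) (R : realType).
Variables (n : nat) (u : 'I_n -> X * Y -> R).
Hypothesis u_meas : forall i, measurable_fun [set: X * Y] (u i).

Lemma logistic_bounded01 (t : R) : 0 <= logistic t <= 1.
Proof.
have e0 := expR_gt0 (- t).
by rewrite /logistic invr_ge0 invf_le1 ?addr_gt0//; lra.
Qed.

Lemma measurable_logistic : measurable_fun [set: R] (@logistic R).
Proof.
apply: continuous_measurable_fun => t; apply: cvgV.
  by rewrite gt_eqF// addr_gt0// expR_gt0.
apply: cvgD; first exact: cvg_cst.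
by apply: (continuous_comp (f := -%R)); [exact: opp_continuous|exact: continuous_expR].
Qed.

Lemma pbar_bounded01 x y y' : 0 <= pbar u x y y' <= 1.
Proof.
(* An empty average is 0, by the convention [0^-1 = 0]. *)
rewrite /pbar; have [n0|n0] := eqVneq (n%:R : R) 0.
  by rewrite n0 invr0 mul0r lexx ler01.
have sum0 : 0 <= \sum_(i < n) logistic (u i (x, y) - u i (x, y')).
  apply: sumr_ge0 => i _.
  by have /andP[] := logistic_bounded01 (u i (x, y) - u i (x, y')).
rewrite mulr_ge0 ?invr_ge0//= mulrC ler_pdivrMr ?lt0r ?n0//= mul1r.
apply: (@le_trans _ _ (\sum_(i < n) 1)); last by rewrite sumr_const card_ord.
apply: ler_sum => i _.
by have /andP[] := logistic_bounded01 (u i (x, y) - u i (x, y')).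
Qed.

Lemma measurable_pbar dT (T : measurableType dT) (a : T -> X) (b c : T -> Y) :
  measurable_fun [set: T] a -> measurable_fun [set: T] b ->
  measurable_fun [set: T] c ->
  measurable_fun [set: T] (fun t => pbar u (a t) (b t) (c t)).
Proof.
move=> ma mb mc; apply: measurable_funM => //; apply: measurable_sum => i.
apply: (measurableT_comp measurable_logistic); apply: measurable_funB.
- by apply: (measurableT_comp (u_meas i)); exact: measurable_fun_pair.
- by apply: (measurableT_comp (u_meas i)); exact: measurable_fun_pair.
Qed.

Lemma measurable_CC (eps : R) :
  measurable [set z : X * (Y * Y * Y) | CC u eps z.1 z.2].
Proof.
pose p12 (z : X * (Y * Y * Y)) := pbar u z.1 z.2.1.1 z.2.1.2.
pose p23 (z : X * (Y * Y * Y)) := pbar u z.1 z.2.1.2 z.2.2.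
pose p31 (z : X * (Y * Y * Y)) := pbar u z.1 z.2.2 z.2.1.1.
have m1 : measurable_fun [set: X * (Y * Y * Y)] (fun z => z.2.1.1).
  apply: (measurableT_comp measurable_fst).
  exact: (measurableT_comp measurable_fst measurable_snd).
have m2 : measurable_fun [set: X * (Y * Y * Y)] (fun z => z.2.1.2).
  apply: (measurableT_comp measurable_snd).
  exact: (measurableT_comp measurable_fst measurable_snd).
have m3 : measurable_fun [set: X * (Y * Y * Y)] (fun z => z.2.2).
  exact: (measurableT_comp measurable_snd measurable_snd).
have m12 : measurable_fun [set: X * (Y * Y * Y)] p12 by exact: measurable_pbar.
have m23 : measurable_fun [set: X * (Y * Y * Y)] p23 by exact: measurable_pbar.
have m31 : measurable_fun [set: X * (Y * Y * Y)] p31 by exact: measurable_pbar.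
have ge (c : R) (p : X * (Y * Y * Y) -> R) : measurable_fun [set: X * (Y * Y * Y)] p ->
    measurable [set z | c <= p z].
  move=> mp; rewrite -[X in measurable X]setTI.
  by apply: measurable_fun_le => //; exact: measurable_cst.
have le (c : R) (p : X * (Y * Y * Y) -> R) : measurable_fun [set: X * (Y * Y * Y)] p ->
    measurable [set z | p z <= c].
  move=> mp; rewrite -[X in measurable X]setTI.
  by apply: measurable_fun_le => //; exact: measurable_cst.
rewrite (_ : mkset _ =
  ([set z | 2^-1 + eps <= p12 z] `&` [set z | 2^-1 + eps <= p23 z] `&`
   [set z | 2^-1 + eps <= p31 z]) `|`
  ([set z | p12 z <= 2^-1 - eps] `&` [set z | p23 z <= 2^-1 - eps] `&`
   [set z | p31 z <= 2^-1 - eps])).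
  by apply: measurableU; (apply: measurableI; [apply: measurableI|]);
    (exact: ge || exact: le).
apply/seteqP; split => -[x [[y1 y2] y3]] /=.
  by move=> [[? ? ?]|[? ? ?]]; [left|right].
by move=> [[[? ?] ?]|[[? ?] ?]]; [left|right].
Qed.

End preferences.

(** * Product laws of responses and their soft update *)

Section round.
Context dX dY (X : measurableType dX) (Y : measurableType dY) (R : realType).
Implicit Types (mu : R.-pker X ~> Y).

Lemma measurable_fiber2_integral mu (F : X * (Y * Y) -> \bar R) :
  measurable_fun [set: X * (Y * Y)] F -> (forall z, 0 <= F z)%E ->
  measurable_fun [set: X] (fun x => \int[fiber2 mu x]_z F (x, z))%E.
Proof.
move=> mF F0.
exact: (measurable_fun_integral_finite_kernel F (kernel_product mu mu)).
Qed.

Lemma measurable_fiber3 mu (A : set (X * (Y * Y * Y))) : measurable A ->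
  measurable_fun [set: X] (fun x => fiber3 mu x [set w | A (x, w)]).
Proof.
move=> mA.
have := @measurable_fun_xsection_finite_kernel _ _ _ _ _
  (kernel_product (kernel_product mu mu) mu) A.
rewrite inE => /(_ mA); congr measurable_fun; apply/funext => x.
by congr (fiber3 mu x _); apply/seteqP; split => w; rewrite /xsection /= inE.
Qed.

Section soft_update_densities.
Variables (mu mu' : R.-pker X ~> Y) (r : X * Y -> R) (beta : R).
Hypothesis mr : measurable_fun [set: X * Y] r.
Hypothesis upd : soft_update mu mu' r beta.

Lemma rho_ge0 x y : 0 <= rho mu r beta x y.
Proof.
by rewrite /rho divr_ge0 ?expR_ge0// fine_ge0// expectation_ge0.
Qed.

Lemma measurable_rho x : measurable_fun [set: Y] (rho mu r beta x).
Proof.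
apply: measurable_funM => //; apply: measurableT_comp => //.
by apply: measurable_funM => //; exact: measurableT_comp.
Qed.

Lemma fiber2_soft_update x A : measurable A ->
  (fiber2 mu' x A = \int[fiber2 mu x]_(z in A)
    (rho mu r beta x z.1 * rho mu r beta x z.2)%:E)%E.
Proof.
have [_ mu'E] := upd x.
by apply: pprod_tilt => //; [exact: measurable_rho|exact: measurable_rho|
  exact: rho_ge0|exact: rho_ge0].
Qed.

Lemma fiber3_soft_update x A : measurable A ->
  (fiber3 mu' x A = \int[fiber3 mu x]_(w in A)
    (rho mu r beta x w.1.1 * rho mu r beta x w.1.2 * rho mu r beta x w.2)%:E)%E.
Proof.
have [_ mu'E] := upd x.
apply: (pprod_tilt (w1 := fun z => rho mu r beta x z.1 * rho mu r beta x z.2)).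
- by apply: measurable_funM; apply: (measurableT_comp (measurable_rho x)).
- exact: measurable_rho.
- by move=> z; rewrite mulr_ge0 ?rho_ge0.
- exact: rho_ge0.
- exact: fiber2_soft_update.
- exact: mu'E.
Qed.

End soft_update_densities.

(** Boundedness under a probability makes both integrals finite, so the extended subtraction is
    linear. This reduces the two claims to identities at each prompt. *)
Lemma integralB_bounded01 (P : probability X R) (a b : X -> \bar R) :
  measurable_fun [set: X] a -> measurable_fun [set: X] b ->
  (forall x, 0 <= a x <= 1)%E -> (forall x, 0 <= b x <= 1)%E ->
  (\int[P]_x a x - \int[P]_x b x = \int[P]_x (a x - b x))%E.
Proof.
move=> ma mb a01 b01.
have int01 (c : X -> \bar R) : measurable_fun [set: X] c ->
    (forall x, 0 <= c x <= 1)%E -> P.-integrable [set: X] c.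
  move=> mc c01; have := finite_measure_integrable_cst P 1 measurableT.
  apply: le_integrable => // x _; have /andP[c0 c1] := c01 x.
  by rewrite gee0_abs//= normr1.
by rewrite integralB//; exact: int01.
Qed.

End round.

Theorem proposition5p1 (R : realType) (dX dY : measure_display)
    (X : measurableType dX) (Y : measurableType dY)
    (nu : probability X R)
    (n : nat) (n_ge1 : (1 <= n)%N)
    (u : 'I_n -> X * Y -> R)
    (u_meas : forall i, measurable_fun [set: X * Y] (u i))
    (d : nat)
    (mu : nat -> R.-pker X ~> Y)
    (phi : nat -> X * Y -> d.-tuple R)
    (g : nat -> d.-tuple R -> R)
    (beta : R) (beta_gt0 : 0 < beta)
    (delta : R) (delta_gt0 : 0 < delta) (delta_lt : delta < 4^-1)
    (t : nat)
    (round_t : joint_update u nu (mu t) (mu t.+1) (phi t) (g t) beta) :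
  (e_ u nu (mu t.+1) (phi t) - e_ u nu (mu t) (phi t) =
     Gamma u nu (mu t) (phi t) (g t \o phi t) beta)%E /\
  (P_CC u (2 * delta) nu (mu t.+1) - P_CC u (2 * delta) nu (mu t) =
     Theta u (2 * delta) nu (mu t) (g t \o phi t) beta)%E.
Proof.
have [mphi mg _ upd] := round_t.
have mr : measurable_fun [set: X * Y] (g t \o phi t) by exact: measurableT_comp.
have mphi2 : measurable_fun [set: X * (Y * Y)]
    (fun w => (phi t (w.1, w.2.1), phi t (w.1, w.2.2))).
  apply: measurable_fun_pair; apply: (measurableT_comp mphi).
  - apply: measurable_fun_pair => //.
    exact: (measurableT_comp measurable_fst measurable_snd).
  - apply: measurable_fun_pair => //.
    exact: (measurableT_comp measurable_snd measurable_snd).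
have mpbar2 : measurable_fun [set: X * (Y * Y)] (fun w => pbar u w.1 w.2.1 w.2.2).
  apply: (measurable_pbar u_meas) => //.
  - exact: (measurableT_comp measurable_fst measurable_snd).
  - exact: (measurableT_comp measurable_snd measurable_snd).
have mf x : measurable_fun [set: Y * Y] (fun z => pbar u x z.1 z.2).
  by apply: (measurable_pbar u_meas).
have mpsi x : measurable_fun [set: Y * Y] (fun z => (phi t (x, z.1), phi t (x, z.2))).
  by apply: measurable_fun_pair; apply: (measurableT_comp mphi);
    apply: measurable_fun_pair.
have f01 x z : 0 <= pbar u x z.1 z.2 <= 1 by exact: pbar_bounded01.
split.
  (* The conditioning variable takes values in pairs of tuples, so the rays provide the countable
     dense family. *)
  have mE m : measurable_fun [set: X]
      (fun x => 'E_(fiber2 (mu m) x)[sq_residual u (mu m) (phi t) x])%E.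
    apply: (measurable_cond_exp_residual (@measurable_ray R d) (@ray_generates R d)
      (P := fiber2 (mu m)) (f := fun w => pbar u w.1 w.2.1 w.2.2)
      (psi := fun w => (phi t (w.1, w.2.1), phi t (w.1, w.2.2)))) => //.
    by move=> F mF F0; exact: measurable_fiber2_integral.
  have E01 m x : (0 <= 'E_(fiber2 (mu m) x)[sq_residual u (mu m) (phi t) x] <= 1)%E.
    rewrite expectation_ge0 /=; last by move=> z; exact: sqr_ge0.
    exact: (cond_exp_residual_le1 (fiber2 (mu m) x) (mf x) (f01 x) (mpsi x)).
  rewrite /e_ integralB_bounded01//.
  apply: eq_integral => x _.
  (* As the reward is [g t \o phi t], the density [rho] at a fixed prompt is [k] of the embedding.
     The density of a pair of responses is thus a function of the conditioning variable. *)
  pose k (z : d.-tuple R) :=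
    expR (beta * g t z) / fine (normalizer (mu t) (g t \o phi t) beta x).
  have mk : measurable_fun [set: d.-tuple R] k.
    apply: measurable_funM => //; apply: measurableT_comp => //.
    exact: measurable_funM.
  have k0 z : 0 <= k z.
    by rewrite /k divr_ge0 ?expR_ge0// fine_ge0// expectation_ge0.
  apply: (cond_exp_residual_tilt (mf x) (f01 x) (mpsi x) (k := fun z => k z.1 * k z.2)).
  - by apply: measurable_funM; apply: (measurableT_comp mk).
  - by move=> z; exact: mulr_ge0.
  - by move=> A mA; exact: fiber2_soft_update.
have mCC := measurable_CC u_meas (2 * delta).
have mCCx x : measurable (CC u (2 * delta) x).
  have := measurable_xsection x mCC.
  by congr measurable; apply/seteqP; split => w; rewrite /xsection /= inE.
rewrite /P_CC integralB_bounded01//; first last.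
- by move=> x; rewrite measure_ge0 probability_le1.
- by move=> x; rewrite measure_ge0 probability_le1.
- exact: (measurable_fiber3 (mu t) mCC).
- exact: (measurable_fiber3 (mu t.+1) mCC).
apply: eq_integral => x _.
(* The cycle event involves only [pbar], so it is the same under both laws, and [covariance_tilt]
   applies directly to its indicator. *)
rewrite -!expectation_indic//.
apply: covariance_tilt.
- have mrho := measurable_rho (mu t) beta mr x.
  apply: measurable_funM; last exact: measurableT_comp.
  apply: measurable_funM.
  + exact: (measurableT_comp mrho (measurableT_comp measurable_fst measurable_fst)).
  + exact: (measurableT_comp mrho (measurableT_comp measurable_snd measurable_fst)).
- by move=> w; apply: mulr_ge0; [apply: mulr_ge0|]; exact: rho_ge0.
- by move=> A mA; exact: fiber3_soft_update.
- exact: measurable_indic.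
- by move=> w; rewrite indicE; case: (_ \in _); rewrite ler01 lexx.
Qed.
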